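(* Let $(A,[\cdot,\cdot])$ be a Malcev superalgebra, $(V,\rho)$ a representation of $A$, and $T:V\to A$ a super $\mathcal O$-operator of $A$ associated to $(V,\rho)$. Then the product $$a\cdot b=\rho(T(a))b,\qquad a,b\in V,$$ makes $V$ a pre-Malcev superalgebra.
   Context: All vector spaces are finite dimensional over an algebraically closed field $\mathbb K$ of characteristic zero. A super vector space is a $\mathbb Z_2$-graded space $V=V_{\bar 0}\oplus V_{\bar 1}$; $|x|\in\{0,1\}$ is the parity of a homogeneous element $x$. $gl(V)$ is the $\mathbb Z_2$-graded space of linear endomorphisms of $V$. A Malcev superalgebra is a super vector space $A$ with a bilinear map $[\cdot,\cdot]:A\times A\to A$, $[A_\alpha,A_\beta]\subseteq A_{\alpha+\beta}$, such that for all homogeneous $x,y,z,t$: $[x,y]=-(-1)^{|x||y|}[y,x]$ and $$(-1)^{|y||z|}[[x,z],[y,t]]=[[[x,y],z],t]+(-1)^{|x|(|y|+|z|+|t|)}[[[y,z],t],x]+(-1)^{(|x|+|y|)(|z|+|t|)}[[[z,t],x],y]+(-1)^{|t|(|x|+|y|+|z|)}[[[t,x],y],z].$$ A representation of a Malcev superalgebra $A$ on a super vector space $V$ is an even linear map $\rho:A\to gl(V)$ such that, for all homogeneous $x,y,z\in A$, $$\rho([[x,y],z])=\rho(x)\rho(y)\rho(z)-(-1)^{|z|(|x|+|y|)}\rho(z)\rho(x)\rho(y)+(-1)^{|x|(|y|+|z|)}\rho(y)\rho([z,x])-(-1)^{|x|(|y|+|z|)}\rho([y,z])\rho(x).$$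 A super $\mathcal O$-operator of $A$ associated to $(V,\rho)$ is an even linear map $T:V\to A$ such that $[T(a),T(b)]=T\big(\rho(T(a))b-(-1)^{|a||b|}\rho(T(b))a\big)$ for all homogeneous $a,b\in V$. A pre-Malcev superalgebra is a super vector space $A$ with a bilinear product $\cdot$ with $A_\alpha\cdot A_\beta\subseteq A_{\alpha+\beta}$ such that, for all homogeneous $x,y,z,t$, writing $[x,y]=x\cdot y-(-1)^{|x||y|}y\cdot x$, $$(-1)^{|x|(|y|+|z|)}[y,z]\cdot(x\cdot t)+[[x,y],z]\cdot t+(-1)^{|x||y|}y\cdot([x,z]\cdot t)-x\cdot(y\cdot(z\cdot t))+(-1)^{|z|(|x|+|y|)}z\cdot(x\cdot(y\cdot t))=0.$$ *)

(* Defs.v *)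
From HB Require Import structures.
From mathcomp Require Import all_boot all_order all_algebra.

Set Implicit Arguments.
Unset Strict Implicit.
Unset Printing Implicit Defensive.

Import GRing.Theory.
Local Open Scope ring_scope.

(* Parities are booleans, [false] for even and [true] for odd; they add by
   [addb].  In sign exponents they are coerced to [nat], which is harmless
   because the exponents of -1 only matter modulo 2. *)
Record superVectType (K : fieldType) := SuperVectType {
  super_sort :> vectType K;
  homog : bool -> {vspace super_sort};
  homog_direct : (homog false :&: homog true = 0)%VS;
  homog_full : (homog false + homog true = fullv)%VS }.

Definition even_map (K : fieldType) (U V : superVectType K) (f : 'Hom(U, V)) :
    Prop :=
  forall (i : bool) (x : U), x \in homog U i -> f x \in homog V i.

(* The degree-[i] component of gl(V). *)
Definition gl_homog (K : fieldType) (V : superVectType K) (i : bool)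
    (f : 'End(V)) : Prop :=
  forall (j : bool) (v : V), v \in homog V j -> f v \in homog V (i (+) j).

Record superalgebra (K : fieldType) (A : superVectType K)
    (m : A -> A -> A) : Prop := {
  superalgebra_bilinear : bilinear_for *:%R *:%R m;
  superalgebra_graded : forall (i j : bool) (x y : A),
    x \in homog A i -> y \in homog A j -> m x y \in homog A (i (+) j) }.

Record malcev_superalgebra (K : fieldType) (A : superVectType K)
    (br : A -> A -> A) : Prop := {
  malcev_superalgebra_alg : superalgebra br;
  malcev_skew : forall (i j : bool) (x y : A),
    x \in homog A i -> y \in homog A j ->
    br x y = - ((-1) ^+ (i * j) *: br y x);
  malcev_identity : forall (i j k l : bool) (x y z t : A),
    x \in homog A i -> y \in homog A j ->
    z \in homog A k -> t \in homog A l ->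
    (-1) ^+ (j * k) *: br (br x z) (br y t)
    = br (br (br x y) z) t
      + (-1) ^+ (i * (j + k + l)) *: br (br (br y z) t) x
      + (-1) ^+ ((i + j) * (k + l)) *: br (br (br z t) x) y
      + (-1) ^+ (l * (i + j + k)) *: br (br (br t x) y) z }.

Record malcev_representation (K : fieldType) (A V : superVectType K)
    (br : A -> A -> A) (rho : 'Hom(A, 'End(V))) : Prop := {
  malcev_representation_even : forall (i : bool) (x : A),
    x \in homog A i -> gl_homog i (rho x);
  malcev_representation_identity : forall (i j k : bool) (x y z : A),
    x \in homog A i -> y \in homog A j -> z \in homog A k ->
    rho (br (br x y) z)
    = (rho x \o rho y \o rho z)%VF
      - (-1) ^+ (k * (i + j)) *: (rho z \o rho x \o rho y)%VF
      + (-1) ^+ (i * (j + k)) *: (rho y \o rho (br z x))%VF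
      - (-1) ^+ (i * (j + k)) *: (rho (br y z) \o rho x)%VF }.

Record super_O_operator (K : fieldType) (A V : superVectType K)
    (br : A -> A -> A) (rho : 'Hom(A, 'End(V))) (T : 'Hom(V, A)) : Prop := {
  super_O_operator_even : even_map T;
  super_O_operator_identity : forall (i j : bool) (a b : V),
    a \in homog V i -> b \in homog V j ->
    br (T a) (T b) = T (rho (T a) b - (-1) ^+ (i * j) *: rho (T b) a) }.

(* [x, y] for [x] of parity [i] and [y] of parity [j]. *)
Definition supercomm (K : fieldType) (A : superVectType K) (m : A -> A -> A)
    (i j : bool) (x y : A) : A :=
  m x y - (-1) ^+ (i * j) *: m y x.

Record pre_malcev_superalgebra (K : fieldType) (A : superVectType K)
    (m : A -> A -> A) : Prop := {
  pre_malcev_superalgebra_alg : superalgebra m;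
  pre_malcev_identity : forall (i j k l : bool) (x y z t : A),
    x \in homog A i -> y \in homog A j ->
    z \in homog A k -> t \in homog A l ->
    (-1) ^+ (i * (j + k)) *: m (supercomm m j k y z) (m x t)
    + m (supercomm m (i (+) j) k (supercomm m i j x y) z) t
    + (-1) ^+ (i * j) *: m y (m (supercomm m i k x z) t)
    - m x (m y (m z t))
    + (-1) ^+ (k * (i + j)) *: m z (m x (m y t)) = 0 }.

(* Main.v *)
Require Import Defs.
From mathcomp Require Import all_boot all_order all_algebra.

Import GRing.Theory.
Local Open Scope ring_scope.

(** Because [T] intertwines the supercommutator of the product
    [a . b = rho (T a) b] with the bracket of [A], every term of the
    pre-Malcev identity is an operator word in [rho (T x)], [rho (T y)],
    [rho (T z)] and [rho] of brackets of [T x], [T y], [T z], applied to the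
    last argument.  Expanding [rho [[T x, T y], T z]] by the representation
    identity cancels everything except
    [(-1)^(ij) rho (T y) rho [T x, T z]
     + (-1)^(i(j+k)) rho (T y) rho [T z, T x]], where [i], [j], [k] are the
    parities of [x], [y], [z]; this vanishes by super skew-symmetry. *)

Section InducedProduct.

Context {K : fieldType} {A V : superVectType K}.
Context {br : A -> A -> A} {rho : 'Hom(A, 'End(V))} {T : 'Hom(V, A)}.
Context (hrho : malcev_representation br rho).
Context (hT : super_O_operator br rho T).

Let prod (a b : V) : V := rho (T a) b.

Lemma O_operator_prod_superalgebra : superalgebra prod.
Proof.
split.
- split=> [b|a] c x y; rewrite /prod; first
    by rewrite !linearP add_lfunE scale_lfunE.
  by rewrite linearP.
- move=> i j x y hx hy.
  exact: malcev_representation_even hrho _ _ (super_O_operator_even hT hx) _ _ hy.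
Qed.

(** Iterated supercommutators [[x, y], z] carry the sign of the parity
    [i (+) j]; knowing that [[x, y]] has that parity is what lets the
    O-operator identity apply to the outer one. *)
Lemma supercomm_homog {i j : bool} {x y : V} :
  x \in homog V i -> y \in homog V j ->
  supercomm prod i j x y \in homog V (i (+) j).
Proof.
have [_ graded] := O_operator_prod_superalgebra.
move=> hx hy; apply: memvB; first exact: graded.
by apply: memvZ; rewrite addbC; apply: graded.
Qed.

(** The O-operator identity says exactly that [T] is a morphism from the
    supercommutator of the product to the bracket; this turns the pre-Malcev
    identity into one about operators [rho u] with [u] in [A]. *)
Lemma O_operator_supercomm {i j : bool} {x y : V} :
  x \in homog V i -> y \in homog V j ->
  T (supercomm prod i j x y) = br (T x) (T y).
Proof. by move=> hx hy; rewrite (super_O_operator_identity hT hx hy). Qed.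

End InducedProduct.

Theorem theorem3p2 (K : closedFieldType) (charK0 : [pchar K] =i pred0)
  (A : superVectType K) (br : A -> A -> A) (hA : malcev_superalgebra br)
  (V : superVectType K) (rho : 'Hom(A, 'End(V)))
  (hrho : malcev_representation br rho)
  (T : 'Hom(V, A)) (hT : super_O_operator br rho T) :
  pre_malcev_superalgebra (fun a b : V => rho (T a) b).
Proof.
split; first exact: O_operator_prod_superalgebra hrho hT.
move=> i j k l x y z t hx hy hz _.
have Teven := super_O_operator_even hT.
rewrite (O_operator_supercomm hT (supercomm_homog hrho hT hx hy) hz).
rewrite !(O_operator_supercomm hT hx, O_operator_supercomm hT hy) //.
rewrite (malcev_representation_identity hrho
  (Teven _ _ hx) (Teven _ _ hy) (Teven _ _ hz)).
(* The representation identity produces [T z, T x], the pre-Malcev one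
   [T x, T z]; reversing the latter makes the two terms comparable. *)
rewrite (malcev_skew hA (Teven _ _ hx) (Teven _ _ hz)).
rewrite !(add_lfunE, opp_lfunE, scale_lfunE, comp_lfunE).
rewrite [rho (- _)]linearN /= [rho (_ *: _)]linearZ /= opp_lfunE scale_lfunE.
rewrite [rho (T y) (- _)]linearN /= [rho (T y) (_ *: _)]linearZ /=.
(* The signs agree: (-1)^(ij) (-1)^(ik) = (-1)^(i(j+k)). *)
rewrite scalerN scalerA -exprD -mulnDr.
set Q := _ *: rho (br _ _) _; set R := _ *: rho (T y) _.
set S := _ *: rho (T z) _; set P := rho (T x) _.
by rewrite [Q + _]addrC subrK addrK [P - S - P]addrAC subrK subrr.
Qed.
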